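(* For any fixed integer $r\geqslant 3$, let $m=m(n)$ be an integer with $m=o(n^{4/3})$. Then, as $n\to\infty$, $$|\mathcal{L}_r(n,m)|=\frac{N_r^m}{m!}\exp\left[-\frac{[r]_2^2\,[m]_2}{4n^2}+O\left(\frac{m^2}{n^3}+\frac{m^3}{n^4}\right)\right].$$
   Context: $N_r=\binom{n}{r}$, and $[x]_t=x(x-1)\cdots(x-t+1)$ is the falling factorial. $O$ and $o$ refer to $n\to\infty$. An $r$-graph on vertex set $[n]=\{1,\ldots,n\}$ has as edge set a set of $r$-subsets of $[n]$; it is linear if any two distinct edges intersect in at most one vertex. $\mathcal{L}_r(n,m)$ is the set of linear $r$-graphs on vertex set $[n]$ with exactly $m$ edges. *)

(* Defs.v *)
From mathcomp Require Import all_boot.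

Set Implicit Arguments.
Unset Strict Implicit.
Unset Printing Implicit Defensive.

(* An r-graph on the vertex set 'I_n is identified with its set of edges. *)
Definition uniform (n r : nat) (E : {set {set 'I_n}}) : bool :=
  [forall e in E, #|e| == r].

Definition linear_hypergraph (n : nat) (E : {set {set 'I_n}}) : bool :=
  [forall e in E, forall f in E, (e != f) ==> (#|e :&: f| <= 1)].

Definition linear_rgraphs (r n m : nat) : {set {set {set 'I_n}}} :=
  [set E | [&& uniform r E, linear_hypergraph E & #|E| == m]].

(* Main.v *)
Require Import Defs.
From mathcomp Require Import all_boot all_order all_algebra.
From mathcomp Require Import all_classical all_reals all_analysis.
From mathcomp Require Import ring lra zify.
(* The names common to finite sets and classical sets denote finite sets. *)
From mathcomp Require Import fintype finset.

Set Implicit Arguments.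
Unset Strict Implicit.
Unset Printing Implicit Defensive.

Import Order.TTheory GRing.Theory Num.Theory.
Import numFieldNormedType.Exports.

(** A linear r-graph is built one edge at a time. Write a_k for the number of
    linear r-graphs with k edges on n vertices, N = 'C(n, r), and
    q = [r]_2^2 / 2. Removing an edge from a linear r-graph with k+1 edges
    gives one with k edges, so (k+1) a_(k+1) is the sum, over the linear
    r-graphs H with k edges, of the number N - excluded(H) of r-sets that may
    be added to H ([switching], [edge_count]). An r-set is excluded when it
    shares two vertices with some edge f of H. A fixed pair of vertices lies in
    N [r]_2 / [n]_2 of the r-sets and H covers k 'C(r, 2) pairs, so
    excluded(H) / N is about k q / n^2.

    The union bound gives the upper estimate of excluded(H) at once
    ([excluded_le]). For the lower one ([excluded_ge]), the Bonferroni
    correction counts r-sets that contain two distinct covered pairs. Two pairs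
    span four vertices, except when they come from the same edge or from two
    edges meeting in a vertex, when they span at least three; as a t-set lies
    in at most N (r/n)^t of the r-sets, the relative loss is
    O((k + D(H)) / n^3 + k^2 / n^4), where D(H) is the number of ordered pairs
    of distinct edges of H that meet. For an individual H the number D(H) may
    be too large, but only its mean matters, and the same removal of one edge
    shows that this mean is O(k^2 / n): among the N r-sets, only O(k N / n)
    meet an edge of the smaller graph, while at least N / 2 may be added to it
    ([mean_meetings_le]).

    Hence (k+1) a_(k+1) / (a_k N) = 1 - k q / n^2 + O(k / n^3 + k^2 / n^4), as
    long as k q / n^2 stays below 1/4 ([ratio_ge], [ratio_le]). Taking
    logarithms keeps an error of this form ([step_bounds]), and summing over
    k < m turns k q / n^2 into q [m]_2 / (2 n^2) = [r]_2^2 [m]_2 / (4 n^2) and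
    the errors into O(m^2 / n^3 + m^3 / n^4) ([log_count_bound]). The
    growth condition on m keeps all k < m in the required range. *)

(** * Union bounds *)

(** A point lying in d > 0 of the sets contributes d on the left. On the right
    it contributes 1 through the union and, for any one set containing it, at
    least d - 1 through the intersections with the other sets. The intersections
    are counted twice (both orders), which costs only a constant factor. *)
Lemma bonferroni (I T : finType) (P : {set I}) (A : I -> {set T}) :
  \sum_(i in P) #|A i| <=
    #|\bigcup_(i in P) A i| +
    \sum_(i in P) \sum_(j in P | j != i) #|A i :&: A j|.
Proof.
have cardE (B : {set T}) : #|B| = \sum_(x : T) (x \in B)%N.
  by rewrite -sum1_card big_mkcond; apply: eq_bigr => x _; case: (x \in B).
under eq_bigr do rewrite cardE.
under [X in _ <= _ + X]eq_bigr do
  (under eq_bigr do rewrite cardE; rewrite exchange_big /=).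
rewrite exchange_big [X in _ <= _ + X]exchange_big /= cardE -big_split /=.
apply: leq_sum => x _.
case: (boolP (x \in \bigcup_(i in P) A i)) => [/bigcupP[i iP xi]|xN].
  rewrite (bigD1 i) //= xi leq_add2l.
  rewrite [leqRHS](bigD1 i) //=; apply: leq_trans (leq_addr _ _).
  by apply: leq_sum => j _; rewrite inE xi.
rewrite big1 // => i iP; apply/eqP; rewrite eqb0; apply: contra xN => xi.
by apply/bigcupP; exists i.
Qed.

Lemma leq_card_bigcup (I T : finType) (P : {set I}) (A : I -> {set T}) :
  #|\bigcup_(i in P) A i| <= \sum_(i in P) #|A i|.
Proof.
elim/big_rec2: _ => [|i y B _ IH]; first by rewrite cards0.
by apply: leq_trans (leq_card_setU _ _) _; rewrite leq_add2l.
Qed.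

(** * The r-sets that contain a given set, or share a pair with it *)

Section Stars.
Variables (T : finType) (r : nat).
Implicit Types s e f : {set T}.

Definition star s : {set {set T}} :=
  [set e : {set T} | (#|e| == r) && (s \subset e)].
Definition conflicts f : {set {set T}} :=
  [set e : {set T} | (#|e| == r) && (1 < #|e :&: f|)].
Definition pairs f : {set {set T}} :=
  [set p : {set T} | (p \subset f) && (#|p| == 2)].

(** Complementation maps the r-sets containing s to the (#|T| - r)-subsets of
    the complement of s. Unlike the count 'C(#|T| - #|s|, r - #|s|), the
    resulting formula is also right when #|s| > r. *)
Lemma card_star_bin s : r <= #|T| -> #|star s| = 'C(#|T| - #|s|, #|T| - r).
Proof.
move=> rT; have -> : #|T| - #|s| = #|~: s| by rewrite [RHS]cardsCs setCK.
rewrite -cards_draws -[RHS](card_imset _ (@setC_inj T)); apply: eq_card => A.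
rewrite -[A]setCK mem_imset; last exact: setC_inj.
rewrite !inE setCS andbC [#|~: ~: A|]cardsCs setCK [#|~: A|]cardsCs setCK.
by congr andb; have := max_card A; lia.
Qed.

Lemma card_star s : r <= #|T| ->
  #|star s| * #|T| ^_ #|s| = 'C(#|T|, r) * r ^_ #|s|.
Proof.
move=> rT; rewrite card_star_bin // -[in RHS](bin_sub rT).
have := max_card s; elim: #|s| => [|t IH] tT; first by rewrite subn0 !ffactn0.
rewrite !ffactnSr [_ * (_ - t)]mulnC mulnA subnS
  [_ * (_ - t)]mulnC mul_bin_down.
rewrite -mulnA IH; last exact: ltnW.
by rewrite subnAC subKn // [_ * (r - t)]mulnC mulnCA.
Qed.

Lemma star_setU s1 s2 : star (s1 :|: s2) = star s1 :&: star s2.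
Proof. by apply/setP => e; rewrite !inE subUset; case: (#|e| == r). Qed.

Lemma conflicts_bigcup f : conflicts f = \bigcup_(p in pairs f) star p.
Proof.
apply/setP => e; rewrite !inE; apply/andP/bigcupP => [[er ef]|[p]].
  have /set0Pn[p] :
    [set p : {set T} | (p \subset e :&: f) & (#|p| == 2)] != set0.
    by rewrite -cards_eq0 cards_draws -lt0n bin_gt0.
  rewrite inE subsetI => /andP[/andP[pe pf] p2].
  by exists p; rewrite !inE ?pf ?er.
rewrite !inE => /andP[pf /eqP p2] /andP[-> pe]; split=> //.
by rewrite -p2; apply: subset_leq_card; rewrite subsetI pe.
Qed.

Lemma card_pairs f : #|pairs f| = 'C(#|f|, 2).
Proof. exact: cards_draws. Qed.

End Stars.

(** * Removing one edge from a linear r-graph *)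

Section Switching.
Variables (n r : nat).
Hypothesis r_gt1 : 1 < r.
Implicit Types (H : {set {set 'I_n}}) (e f : {set 'I_n}).

Definition admissible H : {set {set 'I_n}} :=
  [set e : {set 'I_n} | (#|e| == r) && [forall f in H, #|e :&: f| <= 1]].

Lemma admissible_notin H f : f \in admissible H -> f \notin H.
Proof.
rewrite inE => /andP[/eqP fr /forall_inP Hf]; apply: contraL r_gt1 => /Hf.
by rewrite setIid fr -leqNgt.
Qed.

Lemma linear_rgraphs_add H f k : f \notin H ->
  (f |: H \in linear_rgraphs r n k.+1) =
  (H \in linear_rgraphs r n k) && (f \in admissible H).
Proof.
move=> fH; rewrite !inE cardsU1 fH add1n eqSS.
apply/and3P/andP => [[/forall_inP U /forall_inP L kH]|].
  have inU e : e \in H -> e \in f |: H by move=> eH; rewrite inE eH orbT.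
  split.
    rewrite kH andbT; apply/andP; split; apply/forall_inP => e eH.
      by apply: U; apply: inU.
    apply/forall_inP => g gH.
    exact: (forall_inP (L _ (inU _ eH)) _ (inU _ gH)).
  rewrite U ?setU11 //; apply/forall_inP => g gH.
  have := forall_inP (L _ (setU11 f H)) _ (inU _ gH); rewrite implybE.
  by case: eqP => // fg; rewrite fg gH in fH.
move=> [/and3P[/forall_inP U /forall_inP L kH] /andP[fr /forall_inP F]].
split=> //; apply/forall_inP => e /setU1P[->//|eH]; first exact: U.
  apply/forall_inP => g /setU1P[->|gH]; first by rewrite eqxx.
  by rewrite F ?implybT.
apply/forall_inP => g /setU1P[->|gH]; last exact: (forall_inP (L _ eH)).
by rewrite setIC F ?implybT.
Qed.

(** Double counting of the pairs (linear r-graph, one of its edges): removing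
    the edge is a bijection onto the pairs (smaller graph, r-set that may be
    added to it). The weight F makes it usable both for counting graphs and for
    averaging a statistic of the removed edge. *)
Lemma switching (F : {set {set 'I_n}} -> {set 'I_n} -> nat) k :
  \sum_(H in linear_rgraphs r n k.+1) \sum_(f in H) F (H :\ f) f =
  \sum_(H in linear_rgraphs r n k) \sum_(f in admissible H) F H f.
Proof.
rewrite !pair_big_dep /=.
rewrite (reindex_onto
  (fun p : {set {set 'I_n}} * {set 'I_n} => (p.2 |: p.1, p.2))
  (fun p => (p.1 :\ p.2, p.2))) /=; last first.
  by case=> H f /= /andP[_ fH]; rewrite setD1K.
apply: congr_big => // -[H f] /=.
  rewrite setU11 andbT xpair_eqE eqxx andbT.
  case: (boolP (f \in H)) => fH.
    have -> : (f |: H) :\ f == H = false.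
      by apply/negP => /eqP E; move: fH; rewrite -E !inE eqxx.
    by rewrite andbF; apply/esym/negP => /andP[_ /admissible_notin]; rewrite fH.
  by rewrite setU1K // eqxx andbT linear_rgraphs_add.
by move=> /andP[_ /eqP[->]].
Qed.

Lemma linear_rgraphs0 : linear_rgraphs r n 0 = [set set0].
Proof.
apply/setP => H; rewrite !inE cards_eq0.
case: eqP => [->|]; last by rewrite !andbF.
by rewrite andbT; apply/andP; split; apply/forall_inP => e; rewrite inE.
Qed.

Lemma linear_rgraphsP H k : H \in linear_rgraphs r n k ->
  [/\ forall e, e \in H -> #|e| = r,
      {in H &, forall e f, e != f -> #|e :&: f| <= 1} & #|H| = k].
Proof.
rewrite inE => /and3P[/forall_inP U /forall_inP L /eqP kH]; split=> //.
  by move=> e /U /eqP.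
by move=> e f eH fH ef; have := forall_inP (L _ eH) _ fH; rewrite ef.
Qed.

Lemma card_admissible H :
  #|admissible H| + #|\bigcup_(f in H) conflicts r f| = 'C(n, r).
Proof.
rewrite -[n in 'C(n, _)]card_ord -card_draws.
rewrite -(cardsID (admissible H) [set A : {set 'I_n} | #|A| == r]).
congr (_ + _).
  by apply: eq_card => e; rewrite !inE; case: (#|e| == r).
apply: eq_card => e; rewrite !inE; case: (#|e| =P r) => [er|er] /=; last first.
  by apply/negP => /bigcupP[f _]; rewrite inE => /andP[/eqP //].
rewrite andbT negb_forall; apply/bigcupP/existsP => -[f].
  by rewrite inE => fH /andP[_ ef]; exists f; rewrite fH -ltnNge.
by rewrite negb_imply -ltnNge => /andP[fH ef]; exists f; rewrite ?inE ?er ?eqxx.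
Qed.

End Switching.

(** * How many r-sets a linear r-graph excludes *)

Section Density.
Variables (R : realFieldType) (n r : nat).
Hypotheses (r_gt1 : 1 < r) (r_le_n : r <= n).
Implicit Types (H : {set {set 'I_n}}) (e f g s p q : {set 'I_n}).

Local Open Scope ring_scope.

Local Notation N := ('C(n, r)%:R : R).
Local Notation c2 := ('C(r, 2)%:R : R).
Local Notation x := (r%:R / n%:R : R).
Local Notation beta := ((r ^_ 2)%:R / (n ^_ 2)%:R : R).

Let n_gt0 : (0 < n)%N. Proof. exact: leq_trans (ltnW r_gt1) r_le_n. Qed.

Let x_ge0 : 0 <= x. Proof. by rewrite divr_ge0 ?ler0n. Qed.

Let x_le1 : x <= 1.
Proof. by rewrite ler_pdivrMr ?ltr0n // mul1r ler_nat. Qed.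

Lemma ffact_ratio t : (r ^_ t * n ^ t <= r ^ t * n ^_ t)%N.
Proof.
elim: t => [|t IH]; first by rewrite !ffactn0.
rewrite !ffactnSr !expnSr mulnACA [leqRHS]mulnACA; apply: leq_mul => //.
rewrite mulnBl mulnBr leq_sub2l // mulnC leq_mul2l r_le_n orbT //.
Qed.

(** The exact density of the r-sets containing s is [r]_u / [n]_u with u = #|s|,
    which is at most (r/n)^u factor by factor. *)
Lemma star_le s t : (t <= #|s|)%N -> #|star r s|%:R <= N * x ^+ t.
Proof.
move=> ts; apply: (@le_trans _ _ (N * x ^+ #|s|)); last first.
  by rewrite ler_wpM2l ?ler0n // ler_wiXn2l.
have F0 : (0 < n ^_ #|s|)%N by rewrite ffact_gt0 -[leqRHS]card_ord max_card.
rewrite expr_div_n mulrA ler_pdivlMr ?exprn_gt0 ?ltr0n //.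
rewrite -!natrX -!natrM ler_nat -(leq_pmul2r F0).
rewrite mulnAC -[X in (_ * X ^_ _ * _)%N]card_ord card_star ?card_ord //.
by rewrite -!mulnA leq_mul2l ffact_ratio orbT.
Qed.

Lemma star_pair p : #|p| = 2%N -> #|star r p|%:R = N * beta.
Proof.
move=> p2; have F0 : (n ^_ 2)%:R != 0 :> R.
  by rewrite pnatr_eq0 -lt0n ffact_gt0 (leq_trans r_gt1).
apply: (mulIf F0); rewrite mulrA divfK // -!natrM; congr (_%:R).
by rewrite -p2 -[X in (_ * X ^_ _)%N]card_ord card_star ?card_ord // p2.
Qed.

(** conflicts r f is the union of the 'C(r, 2) stars of the pairs in f, each of
    density exactly beta; the loss in [conflicts_ge] comes from the r-sets that
    contain two pairs of f. *)
Lemma conflicts_le f : #|f| = r -> #|conflicts r f|%:R <= N * (c2 * beta).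
Proof.
move=> fr; rewrite conflicts_bigcup.
apply: le_trans (_ : (\sum_(p in pairs f) #|star r p|)%:R <= _).
  by rewrite ler_nat leq_card_bigcup.
rewrite natr_sum (eq_bigr (fun=> N * beta)); last first.
  by move=> p; rewrite inE => /andP[_ /eqP /star_pair].
by rewrite sumr_const card_pairs fr -[leLHS]mulr_natl mulrCA.
Qed.

Lemma sum_pairs_le f g (F : {set 'I_n} -> {set 'I_n} -> R)
    (P : pred ({set 'I_n} * {set 'I_n})) (b : R) :
  #|f| = r -> #|g| = r -> 0 <= b ->
  {in pairs f & pairs g, forall p q, P (p, q) -> F p q <= b} ->
  \sum_(p in pairs f) \sum_(q in pairs g | P (p, q)) F p q <= c2 ^+ 2 * b.
Proof.
move=> fr gr b0 Fb.
apply: le_trans (_ : \sum_(p in pairs f) \sum_(q in pairs g) b <= _).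
  apply: ler_sum => p pf; rewrite big_mkcondr; apply: ler_sum => q qg.
  by case: ifP => // Ppq; apply: Fb.
by rewrite !sumr_const !card_pairs fr gr -mulrnA -[leLHS]mulr_natl natrM expr2.
Qed.

Lemma conflicts_ge f : #|f| = r ->
  N * (c2 * beta) <= #|conflicts r f|%:R + N * (c2 ^+ 2 * x ^+ 3).
Proof.
move=> fr; rewrite conflicts_bigcup.
apply: le_trans (_ : (\sum_(p in pairs f) #|star r p|)%:R <= _).
  rewrite natr_sum (eq_bigr (fun=> N * beta)); last first.
    by move=> p; rewrite inE => /andP[_ /eqP /star_pair].
  by rewrite sumr_const card_pairs fr -[leRHS]mulr_natl [leRHS]mulrCA.
apply: le_trans (_ : (#|\bigcup_(p in pairs f) star r p| +
  \sum_(p in pairs f) \sum_(q in pairs f | q != p)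
     #|star r p :&: star r q|)%N%:R <= _); first by rewrite ler_nat bonferroni.
rewrite natrD lerD2l natr_sum.
under eq_bigr do rewrite natr_sum.
rewrite mulrCA.
have b0 : 0 <= N * x ^+ 3 by rewrite mulr_ge0 ?ler0n ?exprn_ge0.
apply: (sum_pairs_le (P := fun pq => pq.2 != pq.1) fr fr b0).
move=> p q; rewrite !inE => /andP[_ /eqP p2] /andP[_ /eqP q2] /= qp.
(* Distinct pairs span at least three vertices. *)
rewrite -star_setU star_le // ltnNge; apply: contra qp => pq2.
have := subsetUl p q; have := subsetUr p q.
rewrite !subEproper !properEcard p2 q2 !ltnNge pq2 !andbF !orbF.
move=> /eqP Eq /eqP Ep.
by apply/eqP; exact: etrans Eq (esym Ep).
Qed.

(** A pair in f and a pair in g share at most #|f :&: g| vertices, hence span at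
    least 4 - #|f :&: g|. *)
Lemma conflictsI_le f g : #|f| = r -> #|g| = r ->
  #|conflicts r f :&: conflicts r g|%:R <=
  N * (c2 ^+ 2 * x ^+ (4 - #|f :&: g|)).
Proof.
move=> fr gr.
apply: le_trans (_ : (\sum_(p in pairs f) \sum_(q in pairs g)
   #|star r (p :|: q)|)%:R <= _).
  rewrite ler_nat !conflicts_bigcup big_distrl /=.
  apply: leq_trans (leq_card_bigcup _ _) _; apply: leq_sum => p pf.
  rewrite setIC big_distrl /=.
  apply: leq_trans (leq_card_bigcup _ _) _; apply: leq_sum => q qf.
  by rewrite setIC star_setU.
rewrite natr_sum mulrCA.
under eq_bigr do (rewrite natr_sum; under eq_bigl do rewrite -[_ \in _]andbT).
have b0 : 0 <= N * x ^+ (4 - #|f :&: g|).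
  by rewrite mulr_ge0 ?ler0n ?exprn_ge0.
apply: (sum_pairs_le (P := predT) fr gr b0).
move=> p q; rewrite !inE => /andP[pf /eqP p2] /andP[qg /eqP q2] _.
apply: star_le; rewrite cardsU p2 q2 leq_sub2l //.
by apply: subset_leq_card; apply: setISS.
Qed.

Definition touching H f : {set {set 'I_n}} := [set g in H | f :&: g != set0].

(** The number of ordered pairs of distinct edges of H that meet; it is written
    in the shape to which [switching] applies. *)
Definition meetings H : nat := \sum_(f in H) #|touching (H :\ f) f|.

Definition excluded H : nat := #|\bigcup_(f in H) conflicts r f|.

Lemma excluded_le H k : H \in linear_rgraphs r n k ->
  (excluded H)%:R <= N * (k%:R * (c2 * beta)).
Proof.
move=> /linear_rgraphsP[U _ kH].
apply: le_trans (_ : (\sum_(f in H) #|conflicts r f|)%:R <= _).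
  by rewrite ler_nat leq_card_bigcup.
rewrite natr_sum; apply: le_trans (_ : \sum_(f in H) N * (c2 * beta) <= _).
  by apply: ler_sum => f /U; apply: conflicts_le.
by rewrite sumr_const kH -[leLHS]mulr_natl mulrCA.
Qed.

(** Distinct edges of H share at most one vertex; those that meet are counted by
    meetings H and contribute order (r/n)^3, while all the others (at most k^2
    pairs) contribute order (r/n)^4. *)
Lemma conflicts_overlap_le H k : H \in linear_rgraphs r n k ->
  (\sum_(f in H) \sum_(g in H | g != f)
     #|conflicts r f :&: conflicts r g|)%:R <=
  N * (c2 ^+ 2 * ((meetings H)%:R * x ^+ 3 + k%:R ^+ 2 * x ^+ 4)).
Proof.
move=> /linear_rgraphsP[U L kH].
rewrite natr_sum; apply: le_trans (_ : \sum_(f in H)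
   N * (c2 ^+ 2 * (#|touching (H :\ f) f|%:R * x ^+ 3 + k%:R * x ^+ 4)) <= _);
   last first.
  rewrite -!mulr_sumr big_split /= -mulr_suml -natr_sum sumr_const kH.
  by rewrite -[(_ * _) *+ k]mulr_natl; rewrite /meetings; lra.
apply: ler_sum => f fH; rewrite natr_sum.
rewrite (bigID (fun g => f :&: g != set0)) /= !mulrDr lerD //.
  apply: le_trans (_ : \sum_(g in touching (H :\ f) f)
     N * (c2 ^+ 2 * x ^+ 3) <= _); last first.
    by rewrite sumr_const -[leLHS]mulr_natl; lra.
  rewrite (eq_bigl (mem (touching (H :\ f) f))); last first.
    by move=> g; rewrite !inE [_ && (g \in H)]andbC.
  apply: ler_sum => g; rewrite !inE => /andP[/andP[gf gH] fg].
  apply: le_trans (conflictsI_le (U _ fH) (U _ gH)) _.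
  rewrite !ler_wpM2l ?ler0n ?exprn_ge0 ?ler0n // ler_wiXn2l //.
  by have := L _ _ gH fH gf; rewrite setIC; lia.
apply: le_trans (_ : \sum_(g in H) N * (c2 ^+ 2 * x ^+ 4) <= _); last first.
  by rewrite sumr_const kH -[leLHS]mulr_natl; lra.
rewrite [leLHS](_ : _ = \sum_(g in H | (g != f) && (f :&: g == set0))
   #|conflicts r f :&: conflicts r g|%:R); last first.
  by apply: eq_bigl => g; rewrite negbK andbA.
rewrite big_mkcondr; apply: ler_sum => g gH; case: ifP => [/andP[_ /eqP fg]|_].
  by have := conflictsI_le (U _ fH) (U _ gH); rewrite fg cards0.
by rewrite mulr_ge0 ?ler0n // mulr_ge0 ?exprn_ge0 ?ler0n.
Qed.

(** Bonferroni is used twice: for the pairs inside each edge, which loses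
    N O(k / n^3), and for the edges of H, which loses the overlaps. *)
Lemma excluded_ge H k : H \in linear_rgraphs r n k ->
  N * (k%:R * (c2 * beta)) <= (excluded H)%:R +
  N * (c2 ^+ 2 * ((k + meetings H)%:R * x ^+ 3 + k%:R ^+ 2 * x ^+ 4)).
Proof.
move=> HL; have [U L kH] := linear_rgraphsP HL.
have cl : N * (k%:R * (c2 * beta)) <=
    (\sum_(f in H) #|conflicts r f|)%:R + k%:R * (N * (c2 ^+ 2 * x ^+ 3)).
  rewrite natr_sum mulrCA -kH ![_%:R * (N * _)]mulr_natl -!sumr_const.
  rewrite -big_split /=.
  by apply: ler_sum => f /U; apply: conflicts_ge.
have bf : (\sum_(f in H) #|conflicts r f|)%:R <= (excluded H)%:R +
   (\sum_(f in H) \sum_(g in H | g != f)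
      #|conflicts r f :&: conflicts r g|)%:R :> R.
  by rewrite -natrD ler_nat bonferroni.
by have := conflicts_overlap_le HL; rewrite natrD; lra.
Qed.

Lemma hit_le g : #|g| = r ->
  #|[set f : {set 'I_n} | (#|f| == r) && (f :&: g != set0)]|%:R <=
  N * (r%:R * x).
Proof.
move=> gr; apply: le_trans (_ : (\sum_(v in g) #|star r [set v]|)%:R <= _).
  rewrite ler_nat; apply: leq_trans (leq_card_bigcup _ _).
  apply: subset_leq_card; apply/subsetP => f; rewrite inE => /andP[fr].
  case/set0Pn => v; rewrite inE => /andP[vf vg].
  by apply/bigcupP; exists v; rewrite // inE fr sub1set.
rewrite natr_sum; apply: le_trans (_ : \sum_(v in g) N * x <= _).
  by apply: ler_sum => v _; rewrite -[x]expr1 star_le ?cards1.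
by rewrite sumr_const gr -[leLHS]mulr_natl mulrCA.
Qed.

(** By [switching], the sum counts the triples (H, f, g) where H has k edges,
    f may be added to H, and g is an edge of H that meets f. Dropping the
    condition that f may be added to H leaves at most N r^2 / n choices of f
    for each g. *)
Lemma sum_meetings_le k :
  (\sum_(H in linear_rgraphs r n k.+1) meetings H)%:R <=
  #|linear_rgraphs r n k|%:R * (k%:R * (N * (r%:R * x))).
Proof.
rewrite (switching r_gt1 (fun H f => #|touching H f|)).
rewrite natr_sum mulr_natl -sumr_const; apply: ler_sum => H HL.
have [U _ kH] := linear_rgraphsP HL.
apply: le_trans (_ : (\sum_(g in H) #|[set f : {set 'I_n} |
   (#|f| == r) && (f :&: g != set0)]|)%:R <= _).
  rewrite ler_nat.
  under eq_bigr do rewrite -sum1_card.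
  under [leqRHS]eq_bigr do rewrite -sum1_card.
  rewrite (exchange_big_dep (mem H)) /=; last first.
    by move=> f g _; rewrite inE => /andP[].
  apply: leq_sum => g gH; rewrite !sum1_card; apply: subset_leq_card.
  apply/subsetP => f; rewrite unfold_in !inE => /andP[/andP[-> _]].
  by case/andP.
rewrite natr_sum mulr_natl -kH -sumr_const; apply: ler_sum => g gH.
exact: hit_le (U _ gH).
Qed.

End Density.

(** * The ratio of consecutive counts *)

Section Ratio.
Variables (R : realFieldType) (n r : nat).
Hypotheses (r_gt1 : 1 < r) (r_le_n : r <= n).

Local Open Scope ring_scope.

Local Notation a k := (#|linear_rgraphs r n k|%:R : R).
Local Notation N := ('C(n, r)%:R : R).
Local Notation c2 := ('C(r, 2)%:R : R).
Local Notation x := (r%:R / n%:R : R).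
Local Notation beta := ((r ^_ 2)%:R / (n ^_ 2)%:R : R).

Lemma edge_count k :
  k.+1%:R * a k.+1 + (\sum_(H in linear_rgraphs r n k) excluded r H)%:R =
  a k * N.
Proof.
have -> : k.+1%:R * a k.+1 =
    (\sum_(H in linear_rgraphs r n k) #|admissible r H|)%:R.
  under [in RHS]eq_bigr do rewrite -sum1_card.
  rewrite -(switching r_gt1 (fun _ _ => 1%N)) -natrM; congr (_%:R).
  rewrite mulnC -sum_nat_const; apply: eq_bigr => H HL.
  by have [_ _ <-] := linear_rgraphsP HL; rewrite sum1_card.
rewrite -natrD -big_split /= -natrM -sum_nat_const; congr (_%:R).
by apply: eq_bigr => H _; apply: card_admissible.
Qed.

Lemma ratio_ge k : a k * N * (1 - k%:R * (c2 * beta)) <= k.+1%:R * a k.+1.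
Proof.
suff : (\sum_(H in linear_rgraphs r n k) excluded r H)%:R <=
    a k * (N * (k%:R * (c2 * beta))).
  by move: (edge_count k); lra.
rewrite natr_sum [leRHS]mulr_natl -sumr_const.
by apply: ler_sum => H; apply: excluded_le.
Qed.

(** By [excluded_le] the hypothesis makes every H exclude at most half of the
    r-sets. Then
    a_k N <= 2 (k+1) a_(k+1), which turns the bound of [sum_meetings_le] in
    terms of the smaller graphs into a bound on a mean. *)
Lemma mean_meetings_le k : k%:R * (c2 * beta) <= 2^-1 ->
  (\sum_(H in linear_rgraphs r n k) meetings H)%:R <=
    a k * (2 * r%:R ^+ 2 * k%:R ^+ 2 / n%:R).
Proof.
case: k => [_|k hk].
  by rewrite linear_rgraphs0 big_set1 /meetings big_set0 expr0n !(mulr0, mul0r).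
apply: le_trans (sum_meetings_le R r_gt1 r_le_n k) _.
have b0 : 0 <= c2 * beta by rewrite !mulr_ge0 ?invr_ge0 ?ler0n.
have half : a k * N <= 2 * (k.+1%:R * a k.+1).
  apply: le_trans (_ : 2 * (a k * N * (1 - k%:R * (c2 * beta))) <= _);
    last by rewrite ler_wpM2l ?ratio_ge.
  have kk : k%:R * (c2 * beta) <= 2^-1.
    by apply: le_trans hk; rewrite ler_wpM2r // ler_nat.
  have aN : 0 <= a k * N by rewrite mulr_ge0 ?ler0n.
  have /(ler_wpM2l aN) := kk; lra.
have -> : a k * (k%:R * (N * (r%:R * x))) =
  (a k * N) * (k%:R * (r%:R * x)) by ring.
have kx : 0 <= k%:R * (r%:R * x) by rewrite !mulr_ge0 ?invr_ge0 ?ler0n.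
apply: le_trans (ler_wpM2r kx half) _.
have -> : a k.+1 * (2 * r%:R ^+ 2 * k.+1%:R ^+ 2 / n%:R) =
  2 * (k.+1%:R * a k.+1) * (k.+1%:R * (r%:R * x)) by ring.
rewrite ler_wpM2l ?mulr_ge0 ?ler0n //.
by rewrite ler_wpM2r ?mulr_ge0 ?invr_ge0 ?ler0n // ler_nat.
Qed.

Lemma ratio_le k : k%:R * (c2 * beta) <= 2^-1 ->
  k.+1%:R * a k.+1 <= a k * N * (1 - k%:R * (c2 * beta) +
    c2 ^+ 2 * ((k%:R + 2 * r%:R ^+ 2 * k%:R ^+ 2 / n%:R) * x ^+ 3
               + k%:R ^+ 2 * x ^+ 4)).
Proof.
move=> /mean_meetings_le hm; have := edge_count k.
have : a k * (N * (k%:R * (c2 * beta))) <=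
    (\sum_(H in linear_rgraphs r n k) excluded r H)%:R +
    N * (c2 ^+ 2 * ((a k * k%:R +
      (\sum_(H in linear_rgraphs r n k) meetings H)%:R) * x ^+ 3 +
       a k * (k%:R ^+ 2 * x ^+ 4))).
  rewrite !natr_sum ![a k * _]mulr_natl -!sumr_const -big_split mulr_suml.
  rewrite -big_split !mulr_sumr -big_split; apply: ler_sum => H HL /=.
  by rewrite -natrD excluded_ge.
have /ler_wpM2l h : 0 <= N * (c2 ^+ 2 * x ^+ 3).
  by rewrite !mulr_ge0 ?exprn_ge0 ?mulr_ge0 ?invr_ge0 ?ler0n.
have := h _ _ hm; lra.
Qed.

End Ratio.

(** * Logarithms *)

Section Log.
Variable R : realType.
Local Open Scope ring_scope.

Lemma ln_1B_bounds (u w z : R) : 0 <= u -> u <= 2^-1 ->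
  1 - u <= z -> z <= 1 - u + w -> - u - 2 * u ^+ 2 <= ln z <= - u + w.
Proof.
move=> u0 u2 uz zw; have z0 : 0 < z by lra.
apply/andP; split; last first.
  by rewrite -[z in ln z](addrNK 1) addrC (le_trans (le_ln1Dx _)) //; lra.
have v0 : 0 < 1 - u by lra.
have le1 : ln (1 - u)^-1 <= u + 2 * u ^+ 2.
  rewrite -[_^-1](addrNK 1) addrC (le_trans (le_ln1Dx _)) //.
    by rewrite ltrBrDr addNr invr_gt0.
  rewrite lerBlDr -[leLHS]mul1r ler_pdivrMr //.
  have : 0 <= u ^+ 2 * (1 - 2 * u) by rewrite mulr_ge0 ?sqr_ge0 //; lra.
  by lra.
rewrite lnV ?posrE // in le1.
by apply: le_trans (_ : ln (1 - u) <= _); [lra | rewrite ler_ln ?posrE].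
Qed.

End Log.

Section LogCount.
Variables (R : realType) (r : nat).
Hypothesis r_gt1 : 1 < r.
Local Open Scope ring_scope.

Local Notation a n k := (#|linear_rgraphs r n k|%:R : R).
Local Notation c2 := ('C(r, 2)%:R : R).

(** The number q = [r]_2^2 / 2 (see [rateE]): adding the edge number k+1 costs a
    factor 1 - k q / n^2. *)
Definition rate : R := c2 * (r ^_ 2)%:R.

(** The term in q comes from replacing n (n - 1) by n^2, the term in q^2 from
    the second order of the logarithm, and the rest from [ratio_le]. *)
Definition err_const : R :=
  2 * rate + 8 * rate ^+ 2 +
  c2 ^+ 2 * (r%:R ^+ 3 + 2 * r%:R ^+ 5 + r%:R ^+ 4).

Lemma rate_gt0 : 0 < rate.
Proof. by rewrite mulr_gt0 ?ltr0n ?bin_gt0 ?ffact_gt0. Qed.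

Lemma rateE : rate = (r ^_ 2)%:R ^+ 2 / 2.
Proof.
rewrite /rate expr2 -bin_ffact natrM (_ : 2`! = 2)%N //.
have : 2 != 0 :> R by rewrite pnatr_eq0.
by move=> ?; field.
Qed.

Definition log_ratio n k : R :=
  ln (k.+1%:R * a n k.+1 / (a n k * 'C(n, r)%:R)).

(** The middle hypothesis bounds k q / (n (n - 1)) by 1/2. It makes the number
    of linear r-graphs with k+1 edges positive, and the logarithm of the ratio
    comparable to its first order term. *)
Lemma step_bounds n k : (r <= n)%N -> 4 * rate * k%:R <= n%:R ^+ 2 ->
  (0 < #|linear_rgraphs r n k|)%N ->
  (0 < #|linear_rgraphs r n k.+1|)%N /\
  `|log_ratio n k + rate * k%:R / n%:R ^+ 2| <=
    err_const * (k%:R / n%:R ^+ 3 + k%:R ^+ 2 / n%:R ^+ 4).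
Proof.
move=> rn kn ak0; have n1 : (1 < n)%N by apply: leq_trans rn.
pose y : R := n%:R^-1; pose t : R := k%:R; pose q := rate.
have q0 : 0 < q := rate_gt0.
have n0 : 0 < n%:R :> R by rewrite ltr0n ltnW.
have y0 : 0 < y by rewrite invr_gt0.
have t0 : 0 <= t by rewrite ler0n.
pose u := t * (c2 * ((r ^_ 2)%:R / (n ^_ 2)%:R)).
have ny : n%:R * y = 1 by rewrite mulfV // gt_eqF.
have y2 : y <= 2^-1.
  by rewrite /y lef_pV2 ?posrE // ler_nat.
(* u is q k / (n (n - 1)), to be compared with t q y^2 = q k / n^2. *)
have uE : u * (1 - y) = t * q * y ^+ 2.
  have nE : (n ^_ 2 = n * (n - 1))%N by rewrite ffactnS ffactn1 subn1.
  rewrite /u nE natrM natrB ?(ltnW n1) //.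
  have n1' : n%:R - 1 != 0 :> R by rewrite subr_eq0 pnatr_eq1 gtn_eqF.
  rewrite /q /rate /y; field; rewrite n1' gt_eqF //.
have u0 : 0 <= u by rewrite !mulr_ge0 ?invr_ge0 ?ler0n.
have s0 : 0 <= t * q * y ^+ 2.
  by rewrite !mulr_ge0 ?exprn_ge0 // ltW.
have sq : t * q * y ^+ 2 <= 4^-1.
  have := ler_wpM2r (exprn_ge0 2 (ltW y0)) kn.
  by rewrite -exprMn ny expr1n -/t -/q; lra.
have u_ge : t * q * y ^+ 2 <= u by rewrite -uE; nra.
have u_le : u <= t * q * y ^+ 2 + 2 * (t * q * y ^+ 3).
  suff : 0 <= (t * q * y ^+ 2 + 2 * (t * q * y ^+ 3) - u) * (1 - y).
    by rewrite pmulr_lge0 ?subr_ge0 //; lra.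
  have -> : (t * q * y ^+ 2 + 2 * (t * q * y ^+ 3) - u) * (1 - y) =
     t * q * y ^+ 2 * (y * (1 - 2 * y)).
    by rewrite mulrBl uE; ring.
  rewrite mulr_ge0 // mulr_ge0 ?(ltW y0) //; lra.
have u_le2 : u <= 2 * (t * q * y ^+ 2) by rewrite -uE; nra.
have u_half : u <= 2^-1 by lra.
set w : R := c2 ^+ 2 * ((k%:R + 2 * r%:R ^+ 2 * k%:R ^+ 2 / n%:R) *
   (r%:R / n%:R) ^+ 3 + k%:R ^+ 2 * (r%:R / n%:R) ^+ 4).
have aN : 0 < a n k * 'C(n, r)%:R by rewrite mulr_gt0 ?ltr0n ?bin_gt0.
have lo := ratio_ge R r_gt1 rn k; have hi := ratio_le r_gt1 rn u_half.
rewrite -/t -/u in lo hi.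
have zlo : 1 - u <= k.+1%:R * a n k.+1 / (a n k * 'C(n, r)%:R).
  by rewrite ler_pdivlMr // mulrC.
have zhi : k.+1%:R * a n k.+1 / (a n k * 'C(n, r)%:R) <= 1 - u + w.
  by rewrite ler_pdivrMr // [leRHS]mulrC.
split.
  have : 0 < k.+1%:R * a n k.+1.
    by apply: lt_le_trans lo; rewrite mulr_gt0 //; lra.
  by rewrite pmulr_rgt0 ?ltr0n.
have /andP[] := ln_1B_bounds u0 u_half zlo zhi.
rewrite -/(log_ratio n k) => l1 l2.
have uu : u ^+ 2 <= 4 * q ^+ 2 * (t ^+ 2 * y ^+ 4).
  have : u ^+ 2 <= (2 * (t * q * y ^+ 2)) ^+ 2.
    by rewrite ler_sqr ?nnegrE //; lra.
  by lra.
pose A : R := t * y ^+ 3; pose B : R := t ^+ 2 * y ^+ 4.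
have A0 : 0 <= A by rewrite mulr_ge0 ?exprn_ge0 ?(ltW y0).
have B0 : 0 <= B by rewrite mulr_ge0 ?exprn_ge0 ?(ltW y0).
have r0 : 0 <= r%:R :> R by rewrite ler0n.
have wE : w = c2 ^+ 2 * (r%:R ^+ 3 * A + (2 * r%:R ^+ 5 + r%:R ^+ 4) * B).
  by rewrite /w /A /B /t /y; field; rewrite gt_eqF.
have -> : k%:R / n%:R ^+ 3 + k%:R ^+ 2 / n%:R ^+ 4 = A + B.
  by rewrite /A /B /t /y !exprVn.
have -> : rate * k%:R / n%:R ^+ 2 = t * q * y ^+ 2.
  by rewrite /q /t /y exprVn; ring.
have K1 : 2 * q * A + 8 * q ^+ 2 * B <= (2 * q + 8 * q ^+ 2) * (A + B).
  have : 0 <= q * B by rewrite mulr_ge0 // ltW.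
  have : 0 <= q ^+ 2 * A by rewrite mulr_ge0 // exprn_ge0 // ltW.
  lra.
have K0 : 0 <= (2 * q + 8 * q ^+ 2) * (A + B).
  by apply: mulr_ge0; apply: addr_ge0 => //;
    rewrite ?mulr_ge0 ?exprn_ge0 ?ler0n ?(ltW q0).
have wle : w <= c2 ^+ 2 * (r%:R ^+ 3 + 2 * r%:R ^+ 5 + r%:R ^+ 4) * (A + B).
  rewrite wE -mulrA ler_wpM2l ?exprn_ge0 ?ler0n //.
  have := mulr_ge0 (exprn_ge0 3 r0) B0; have := mulr_ge0 (exprn_ge0 4 r0) A0.
  have := mulr_ge0 (exprn_ge0 5 r0) A0; lra.
have w0 : 0 <= w.
  rewrite wE; apply: mulr_ge0; first by rewrite exprn_ge0 ?ler0n.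
  have := mulr_ge0 (exprn_ge0 3 r0) A0; have := mulr_ge0 (exprn_ge0 4 r0) B0.
  have := mulr_ge0 (exprn_ge0 5 r0) B0; lra.
have -> : err_const * (A + B) = (2 * q + 8 * q ^+ 2) * (A + B) +
   c2 ^+ 2 * (r%:R ^+ 3 + 2 * r%:R ^+ 5 + r%:R ^+ 4) * (A + B).
  by rewrite /err_const -/q; ring.
rewrite ler_norml; apply/andP; split; last by lra.
have : t * q * y ^+ 3 = q * A by rewrite /A; ring.
rewrite -/B in uu; lra.
Qed.

Definition log_count n k : R := ln (a n k * k`!%:R / 'C(n, r)%:R ^+ k).

Lemma log_countS n k : (r <= n)%N ->
  (0 < #|linear_rgraphs r n k|)%N -> (0 < #|linear_rgraphs r n k.+1|)%N ->
  log_count n k.+1 = log_count n k + log_ratio n k.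
Proof.
move=> rn a0 a1.
have N0 : 0 < 'C(n, r)%:R :> R by rewrite ltr0n bin_gt0.
rewrite /log_count /log_ratio -lnM ?posrE ?divr_gt0 ?mulr_gt0 ?exprn_gt0
  ?ltr0n ?fact_gt0 ?bin_gt0 //.
congr ln; have A0 : a n k != 0 by rewrite pnatr_eq0 -lt0n.
rewrite factS natrM exprS; field.
by rewrite A0 expf_neq0 gt_eqF.
Qed.

(** Summation of [step_bounds]: k becomes [k]_2 / 2 in the main term, while
    k + k^2 <= (k+1)^2 and k^2 + k^3 <= (k+1)^3 absorb the new errors. *)
Lemma log_count_bound n k : (r <= n)%N ->
  4 * rate * k%:R <= n%:R ^+ 2 ->
  (0 < #|linear_rgraphs r n k|)%N /\
  `|log_count n k + (r ^_ 2)%:R ^+ 2 * (k ^_ 2)%:R / (4%:R * n%:R ^+ 2)| <=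
    err_const * (k%:R ^+ 2 / n%:R ^+ 3 + k%:R ^+ 3 / n%:R ^+ 4).
Proof.
move=> rn; have n0 : 0 < n%:R :> R by rewrite ltr0n (leq_trans _ rn) // ltnW.
have K0 : 0 <= err_const.
  have q0 := ltW rate_gt0.
  by rewrite !addr_ge0 ?mulr_ge0 ?addr_ge0 ?mulr_ge0 ?exprn_ge0 ?ler0n.
elim: k => [_|k IH kn].
  rewrite linear_rgraphs0 cards1; split => //.
  rewrite /log_count linear_rgraphs0 cards1.
  by rewrite !(mul1r, mulr0, mul0r, expr0n, divr1, addr0, ln1, normr0, expr0).
have kn' : 4 * rate * k%:R <= n%:R ^+ 2.
  apply: le_trans kn; rewrite ler_wpM2l ?ler_nat //.
  by rewrite mulr_ge0 // ltW // rate_gt0.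
have [a0 ihk] := IH kn'; have [a1 st] := step_bounds rn kn' a0; split=> //.
rewrite log_countS //.
set G : R := n%:R ^+ 2 in ihk st *.
have -> : (r ^_ 2)%:R ^+ 2 * (k.+1 ^_ 2)%:R / (4 * G) =
  (r ^_ 2)%:R ^+ 2 * (k ^_ 2)%:R / (4 * G) + rate * k%:R / G.
  have -> : (k.+1 ^_ 2 = k ^_ 2 + 2 * k)%N.
    by rewrite !ffactnS !ffactn0 !muln1; case: (k) => //= j; lia.
  by rewrite rateE natrD natrM; field; rewrite gt_eqF // exprn_gt0.
rewrite addrACA; apply: le_trans (ler_normD _ _) _.
apply: le_trans (lerD ihk st) _; rewrite -mulrDr ler_wpM2l // addrACA lerD //.
  rewrite -mulrDl ler_wpM2r ?invr_ge0 ?exprn_ge0 ?ler0n //.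
  by rewrite -!natrX -natrD ler_nat; nia.
rewrite -mulrDl ler_wpM2r ?invr_ge0 ?exprn_ge0 ?ler0n //.
by rewrite -!natrX -natrD ler_nat !expnS expn0 !muln1; nia.
Qed.

End LogCount.

(** * The asymptotic formula *)

Local Open Scope classical_set_scope.
Local Open Scope ring_scope.

Theorem corollary1p2 (R : realType) (r : nat) (hr : (3 <= r)%N)
    (m : nat -> nat)
    (hm : (fun n : nat => (m n)%:R : R) =o_\oo
          (fun n : nat => n%:R `^ (4%:R / 3%:R) : R)) :
  exists2 err : nat -> R,
    err =O_\oo (fun n : nat =>
      (m n)%:R ^+ 2 / n%:R ^+ 3 + (m n)%:R ^+ 3 / n%:R ^+ 4 : R) &
    \forall n \near \oo,
      #|linear_rgraphs r n (m n)|%:R =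
        ('C(n, r))%:R ^+ m n / (m n)`!%:R *
        expR (- ((r ^_ 2)%:R ^+ 2 * (m n ^_ 2)%:R / (4%:R * n%:R ^+ 2))
              + err n) :> R.
Proof.
have r_gt1 : (1 < r)%N := ltnW hr.
have q0 : 0 < rate R r := rate_gt0 R r_gt1.
(* n^(4/3) <= n^2, so the sizes m n enter the range of [log_count_bound]. *)
have m_le : \forall n \near \oo, 4 * rate R r * (m n)%:R <= n%:R ^+ 2.
  have e0 : 0 < (4 * rate R r)^-1 by rewrite invr_gt0 mulr_gt0.
  move/eqoP/(_ _ e0): hm; apply: filterS2 (nbhs_infty_ge 1) => n n1.
  rewrite /= ger0_norm ?ler0n // ger0_norm ?powR_ge0 //.
  rewrite mulrC ler_pdivlMr ?(mulr_gt0 _ q0) //.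
  rewrite mulrC => /le_trans; apply.
  rewrite -powR_mulrn ?ler0n // ler_powR ?ler1n //; lra.
(* The error is forced: it is the logarithm of the quotient of the two sides. *)
exists (fun n => log_count R r n (m n) +
   (r ^_ 2)%:R ^+ 2 * (m n ^_ 2)%:R / (4%:R * n%:R ^+ 2)).
  apply/eqOP; exists (err_const R r); split; first exact: num_real.
  move=> K /ltW hK; apply: filterS2 (nbhs_infty_ge r) m_le => n rn mn.
  have [_ h] := log_count_bound r_gt1 rn mn.
  apply: le_trans h _; rewrite [leRHS]/=.
  have g0 : 0 <= (m n)%:R ^+ 2 / n%:R ^+ 3 + (m n)%:R ^+ 3 / n%:R ^+ 4 :> R.
    by rewrite addr_ge0 ?divr_ge0 ?exprn_ge0 ?ler0n.
  by rewrite ger0_norm // ler_wpM2r.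
apply: filterS2 (nbhs_infty_ge r) m_le => n rn mn.
have [a0 _] := log_count_bound r_gt1 rn mn.
have N0 : 0 < 'C(n, r)%:R ^+ m n :> R by rewrite exprn_gt0 // ltr0n bin_gt0.
have f0 : 0 < (m n)`!%:R :> R by rewrite ltr0n fact_gt0.
rewrite addrCA addNr addr0 /log_count lnK; last first.
  by rewrite posrE divr_gt0 ?mulr_gt0 ?ltr0n ?fact_gt0.
by field; rewrite !gt_eqF.
Qed.
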